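(* Let $d\ge1$ be an integer, $\tilde\kappa>0$ and $\lambda\ge0$. Then there exist $R>\frac{C_B}{\tilde\kappa}$ and a non-trivial solution $y$ to $$r y''+(d-1)y'+\tilde\kappa^2r\sinh y=r\lambda,\quad r\in(0,R),\qquad y(R)=\sinh^{-1}\Big(\frac{\lambda}{\tilde\kappa^2}\Big),$$ that is, a solution other than the constant function $r\mapsto\sinh^{-1}(\lambda/\tilde\kappa^2)$.
   Context: $\sinh^{-1}$ is the inverse hyperbolic sine. $C_B>0$ is the constant (depending on $d$) such that the principal Dirichlet eigenvalue of $-\Delta$ on the ball $B(0,R)\subseteq\mathbb{R}^d$ is $\lambda_1=C_B/R^2$. The boundary value problem is the radial form, with $u(x)=y(|x|)$, of $-\Delta u-\tilde\kappa^2\sinh u=-\lambda$ in $B(0,R)$, with constant boundary data $u=\sinh^{-1}(\lambda/\tilde\kappa^2)$ on $\partial B(0,R)$; the constant function $\sinh^{-1}(\lambda/\tilde\kappa^2)$ is called the trivial solution. *)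

(* Defs.v *)
From Stdlib Require Import Reals.
From Coquelicot Require Import Coquelicot.
From mathcomp Require Import ssreflect ssrfun ssrbool eqtype fintype bigop.

Set Implicit Arguments.
Unset Strict Implicit.

Open Scope R_scope.

(* R^d as functions on ['I_d]; its topology is Coquelicot's uniform structure
   on function spaces (sup distance), which for finite d is the usual one. *)
Definition vec (d : nat) : UniformSpace := fct_UniformSpace 'I_d R_UniformSpace.

Definition enorm (d : nat) (x : vec d) : R :=
  sqrt (\big[Rplus/0]_(i < d) (x i) ^ 2).

Definition open_ball (d : nat) (rho : R) (x : vec d) : Prop := enorm x < rho.

Definition closed_ball (d : nat) (rho : R) (x : vec d) : Prop := enorm x <= rho.

Definition set_coord (d : nat) (x : vec d) (i : 'I_d) (t : R) : vec d :=
  fun j => if j == i then t else x j.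

Definition ex_partial (d : nat) (i : 'I_d) (u : vec d -> R) (x : vec d) : Prop :=
  ex_derive (fun t : R => u (set_coord x i t)) (x i).

Definition partial (d : nat) (i : 'I_d) (u : vec d -> R) (x : vec d) : R :=
  Derive (fun t : R => u (set_coord x i t)) (x i).

Definition laplacian (d : nat) (u : vec d -> R) (x : vec d) : R :=
  \big[Rplus/0]_(i < d) partial i (partial i u) x.

(* [D] is meant to be open. *)
Definition C2_on (d : nat) (D : vec d -> Prop) (u : vec d -> R) : Prop :=
  forall x : vec d, D x ->
    continuous u x /\
    (forall i : 'I_d, ex_partial i u x /\ continuous (partial i u) x) /\
    (forall i j : 'I_d, ex_partial j (partial i u) x /\
                        continuous (partial j (partial i u)) x).

(* Eigenvalues of the Dirichlet Laplacian on B(0,rho), with classical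
   eigenfunctions in C^2(B) and continuous up to the boundary. By elliptic
   regularity these are the same eigenvalues as for H^1_0 eigenfunctions. *)
Definition dirichlet_eigenvalue (d : nat) (rho mu : R) : Prop :=
  exists u : vec d -> R,
    C2_on (open_ball rho) u /\
    continuous_on (closed_ball rho) u /\
    (forall x : vec d, open_ball rho x -> - laplacian u x = mu * u x) /\
    (forall x : vec d, enorm x = rho -> u x = 0) /\
    (exists x : vec d, open_ball rho x /\ u x <> 0).

Definition principal_dirichlet_eigenvalue (d : nat) (rho mu : R) : Prop :=
  dirichlet_eigenvalue d rho mu /\
  (forall nu : R, dirichlet_eigenvalue d rho nu -> mu <= nu).

Definition is_ball_constant (d : nat) (C : R) : Prop :=
  0 < C /\
  forall rho : R, 0 < rho -> principal_dirichlet_eigenvalue d rho (C / rho ^ 2).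

(* [y] is only relevant on [0,rho]. *)
Definition C2_inside (rho : R) (y : R -> R) : Prop :=
  forall r : R, 0 < r < rho ->
    ex_derive y r /\ ex_derive (Derive y) r /\ continuous (Derive_n y 2) r.

(* The behaviour required at the centre is y'(0+) = 0 and that y'' has a finite
   limit at 0+: together with [C2_inside] and continuity on [0,rho] this says
   exactly that u(x) = y(|x|) is C^2 in the whole ball, origin included. *)
Definition regular_at_centre (y : R -> R) : Prop :=
  filterlim (Derive y) (at_right 0) (locally 0) /\
  exists l : R, filterlim (Derive_n y 2) (at_right 0) (locally l).

Definition trivial_value (kappa lambda : R) : R := arcsinh (lambda / kappa ^ 2).

Definition radial_solution (d : nat) (kappa lambda rho : R) (y : R -> R) : Prop :=
  C2_inside rho y /\
  continuous_on (fun r : R => 0 <= r <= rho) y /\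
  regular_at_centre y /\
  (forall r : R, 0 < r < rho ->
     r * Derive_n y 2 r + (INR d - 1) * Derive y r + kappa ^ 2 * r * sinh (y r)
     = r * lambda) /\
  y rho = trivial_value kappa lambda.

(* Main.v *)
Require Import Defs.
From Stdlib Require Import Reals Lra Lia Classical.
From Coquelicot Require Import Coquelicot.
Open Scope R_scope.

(* With [a] the trivial value and [w = y - a], the equation reads
   [w'' + n/r w' + g w = 0], where [n = d - 1] and
   [g w = kappa^2 (sinh (a + w) - sinh a)] satisfies [w g(w) >= kappa^2 w^2].
   Integrating [r^n w'] turns the problem with [w 0 = w0] and [w' 0 = 0] into
     [w r = w0 - int_0^r s A(s) ds],  [A s = int_0^1 t^n g (w (s t)) dt],
   which has no singularity at the centre and is solved on [0, T] by iteration in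
   an exponentially weighted sup norm. The energy [w'^2 / 2 + int_0^w g] does not
   increase, so a small [w0] keeps [|w| <= 1]. Finally [w] vanishes somewhere in
   every interval of length [2 pi / kappa] beyond [n / kappa], by a Riccati
   argument; any such zero beyond [C_B / kappa] serves as [rho]. *)

(** * Lipschitz functions and truncation to an interval *)

Definition lipschitz (K : R) (u : R -> R) : Prop :=
  forall x y : R, Rabs (u x - u y) <= K * Rabs (x - y).

Lemma lipschitz_continuous (K : R) (u : R -> R) (x : R) :
  lipschitz K u -> continuous u x.
Proof.
  intros Hu. apply continuity_pt_filterlim. intros eps Heps.
  (* [K] carries no sign, so the modulus of continuity is taken from the positive number
     [Rabs K + 1]. *)
  assert (HK : 0 < Rabs K + 1) by (pose proof (Rabs_pos K); lra).
  exists (eps / (Rabs K + 1)). split; [now apply Rdiv_lt_0_compat|].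
  intros z [_ Hz]. simpl in *. unfold R_dist in *.
  apply Rmult_lt_compat_l with (1 := HK) in Hz.
  replace ((Rabs K + 1) * (eps / (Rabs K + 1))) with eps in Hz by (field; lra).
  pose proof (Hu z x). pose proof (Rle_abs K). pose proof (Rabs_pos (z - x)).
  nra.
Qed.

(** Turns local data into global data: applied to the radius it freezes an iterate beyond [[0, T]],
    applied to the displacement it makes the force bounded and globally Lipschitz. *)
Definition clamp (lo hi x : R) : R := Rmax lo (Rmin x hi).

Lemma clamp_range (lo hi x : R) : lo <= hi -> lo <= clamp lo hi x <= hi.
Proof.
  intros H. unfold clamp, Rmax, Rmin.
  destruct (Rle_dec x hi); destruct (Rle_dec lo _); lra.
Qed.

Lemma clamp_id (lo hi x : R) : lo <= x <= hi -> clamp lo hi x = x.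
Proof.
  intros H. unfold clamp, Rmax, Rmin.
  destruct (Rle_dec x hi); destruct (Rle_dec lo _); lra.
Qed.

Lemma clamp_lipschitz (lo hi : R) : lipschitz 1 (clamp lo hi).
Proof.
  intros x y. unfold clamp, Rmin.
  destruct (Rle_dec x hi); destruct (Rle_dec y hi); unfold Rmax;
  repeat (match goal with |- context [Rle_dec ?a ?b] => destruct (Rle_dec a b) end);
  unfold Rabs;
  repeat (match goal with |- context [Rcase_abs ?a] => destruct (Rcase_abs a) end);
  lra.
Qed.

(** * Contraction principle in a weighted sup norm *)

(** Banach iteration with the norm replaced by bounds of the form [delta * wt t], so that no space
    of functions of finite norm has to be built. [X] is an invariant class closed under pointwise
    limits, and [C] bounds the first step. The iterates converge geometrically, and the contraction
    property carries the limit through [Phi]. *)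
Lemma weighted_fixed_point (X : (R -> R) -> Prop) (Phi : (R -> R) -> R -> R)
  (wt u0 : R -> R) (C : R) :
  (forall t, 0 <= wt t) ->
  (forall u, X u -> X (Phi u)) ->
  (forall u v delta, X u -> X v ->
     (forall t, Rabs (u t - v t) <= delta * wt t) ->
     forall t, Rabs (Phi u t - Phi v t) <= delta / 2 * wt t) ->
  (forall (s : nat -> R -> R) (u : R -> R), (forall k, X (s k)) ->
     (forall t, is_lim_seq (fun k => s k t) (u t)) -> X u) ->
  X u0 ->
  (forall t, Rabs (Phi u0 t - u0 t) <= C * wt t) ->
  exists u, X u /\ forall t, u t = Phi u t.
Proof.
  intros Hwt HX Hcon Hcl HX0 HC.
  pose (s := fun k => Nat.iter k Phi u0).
  assert (Hs : forall k, X (s k)) by (intros k; induction k; simpl; auto).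
  assert (Hstep : forall k t, Rabs (s (S k) t - s k t) <= C / 2 ^ k * wt t).
  { induction k; intros t.
    - simpl. rewrite Rdiv_1_r. apply HC.
    - replace (C / 2 ^ S k) with (C / 2 ^ k / 2)
        by (simpl; field; apply pow_nonzero; lra).
      apply (Hcon (s (S k)) (s k)); auto. }
  (* The bound is the exact sum of the steps [C / 2 ^ j] for [k <= j < k + m], which lets the
     induction on [m] close. *)
  assert (Hdist : forall k m t,
    Rabs (s (k + m)%nat t - s k t) <= 2 * C * (/ 2 ^ k - / 2 ^ (k + m)) * wt t).
  { intros k m t. induction m.
    - rewrite Nat.add_0_r, !Rminus_diag, Rabs_R0. lra.
    - rewrite Nat.add_succ_r.
      pose proof (Hstep (k + m)%nat t) as H1.
      pose proof (Rabs_triang (s (S (k + m)) t - s (k + m)%nat t)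
                              (s (k + m)%nat t - s k t)) as H2.
      replace (s (S (k + m)) t - s (k + m)%nat t + (s (k + m)%nat t - s k t))
        with (s (S (k + m)) t - s k t) in H2 by ring.
      assert (H3 : C / 2 ^ (k + m) * wt t + 2 * C * (/ 2 ^ k - / 2 ^ (k + m)) * wt t
        = 2 * C * (/ 2 ^ k - / 2 ^ S (k + m)) * wt t).
      { simpl. field. split; apply pow_nonzero; lra. }
      lra. }
  assert (Hpow : is_lim_seq (fun k => / 2 ^ k) 0).
  { apply is_lim_seq_ext with (fun k => (/ 2) ^ k).
    - intros k. now rewrite pow_inv.
    - apply is_lim_seq_geom. rewrite Rabs_pos_eq; lra. }
  assert (Hdist' : forall k m t,
    Rabs (s (k + m)%nat t - s k t) <= 2 * C * / 2 ^ k * wt t).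
  { intros k m t. eapply Rle_trans; [apply Hdist|].
    assert (0 < / 2 ^ (k + m)) by (apply Rinv_0_lt_compat, pow_lt; lra).
    assert (HCw : 0 <= C * wt t)
      by (eapply Rle_trans; [apply Rabs_pos|apply HC]).
    nra. }
  assert (Hbound : forall t, is_lim_seq (fun k => 2 * C * / 2 ^ k * wt t) 0).
  { intros t.
    replace (Finite 0) with (Rbar_mult (Rbar_mult (2 * C) 0) (wt t))
      by (simpl; f_equal; ring).
    apply is_lim_seq_scal_r. now apply is_lim_seq_scal_l. }
  assert (Hlim : forall t, ex_finite_lim_seq (fun k => s k t)).
  { intros t. apply ex_lim_seq_cauchy_corr. intros eps.
    assert (Heps : 0 < eps / 2) by (destruct eps; simpl; lra).
    destruct (proj2 (is_lim_seq_spec _ _) (Hbound t) (mkposreal _ Heps)) as [N HN].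
    exists N. simpl in HN. intros i j Hi Hj.
    specialize (HN N (le_n N)).
    pose proof (Hdist' N (i - N)%nat t) as H1.
    pose proof (Hdist' N (j - N)%nat t) as H2.
    replace (N + (i - N))%nat with i in H1 by lia.
    replace (N + (j - N))%nat with j in H2 by lia.
    rewrite Rminus_0_r in HN. apply Rabs_def2 in HN.
    unfold Rabs in *.
    destruct (Rcase_abs _); destruct (Rcase_abs _); destruct (Rcase_abs _); lra. }
  pose (u := fun t => real (Lim_seq (fun k => s k t))).
  assert (Hu : forall t, is_lim_seq (fun k => s k t) (u t)).
  { intros t. apply Lim_seq_correct', Hlim. }
  assert (HXu : X u) by now apply (Hcl s).
  exists u. split; [exact HXu|]. intros t.
  assert (Huk : forall k x, Rabs (u x - s k x) <= 2 * C * / 2 ^ k * wt x).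
  { intros k x.
    apply (is_lim_seq_le (fun m => Rabs (s (m + k)%nat x - s k x))
                         (fun _ => 2 * C * / 2 ^ k * wt x)
                         (Finite (Rabs (u x - s k x))) (Finite (2 * C * / 2 ^ k * wt x))).
    - intros m. rewrite Nat.add_comm. apply Hdist'.
    - apply (is_lim_seq_abs _ (Finite (u x - s k x))).
      apply is_lim_seq_minus'; [|apply is_lim_seq_const].
      now apply (is_lim_seq_incr_n (fun m => s m x) k).
    - apply is_lim_seq_const. }
  (* Contracting the pair [u], [s k] shows that [Phi (s k)] tends to [Phi u]; the same sequence,
     being a shift of the iterates, tends to [u]. *)
  assert (Hphi : is_lim_seq (fun k => s (S k) t) (Phi u t)).
  { assert (Hd : is_lim_seq (fun k => s (S k) t - Phi u t) 0).
    { apply is_lim_seq_abs_0.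
      apply is_lim_seq_le_le with (fun _ => 0) (fun k => 2 * C * / 2 ^ k * wt t).
      - intros k. split; [apply Rabs_pos|].
        rewrite Rabs_minus_sym.
        eapply Rle_trans; [apply (Hcon u (s k)); auto|].
        assert (HCw : 0 <= 2 * C * / 2 ^ k * wt t)
          by (eapply Rle_trans; [apply Rabs_pos|apply (Huk k t)]).
        lra.
      - apply is_lim_seq_const.
      - apply Hbound. }
    replace (Phi u t) with (0 + Phi u t) by ring.
    apply is_lim_seq_ext with (fun k => (s (S k) t - Phi u t) + Phi u t).
    - intros k. ring.
    - apply is_lim_seq_plus'; [exact Hd|apply is_lim_seq_const]. }
  apply is_lim_seq_unique in Hphi.
  pose proof (Hu t) as Hut. apply is_lim_seq_incr_1, is_lim_seq_unique in Hut.
  rewrite Hphi in Hut. now injection Hut.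
Qed.

(** * Radial averages with weight [t ^ n] *)

(** For [r <> 0] this is the integral of [t ^ n * h t] over [[0, r]] divided by [r ^ S n]. The
    rescaled form also makes sense at [r = 0] and inherits bounds and Lipschitz constants from
    [h]. *)
Definition average (n : nat) (h : R -> R) (r : R) : R :=
  RInt (fun t => t ^ n * h (r * t)) 0 1.

Lemma average_integrable (n : nat) (h : R -> R) (r a b : R) :
  (forall x, continuous h x) -> ex_RInt (fun t => t ^ n * h (r * t)) a b.
Proof.
  intros Hh. apply (@ex_RInt_continuous R_CompleteNormedModule). intros t _.
  apply (continuous_mult (fun t => t ^ n) (fun t => h (r * t))).
  - apply (@ex_derive_continuous _ R_NormedModule). auto_derive. exact I.
  - apply (continuous_comp (fun t => r * t) h); [|apply Hh].
    apply (@ex_derive_continuous _ R_NormedModule). auto_derive. exact I.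
Qed.

(** The weight lies in [[0, 1]] on the unit interval. Allowing two functions and two radii at once
    yields the sup bound, the Lipschitz bound and the contraction estimate from one inequality. *)
Lemma average_dist (n : nat) (h k : R -> R) (r s delta : R) :
  (forall x, continuous h x) -> (forall x, continuous k x) ->
  (forall t, 0 <= t <= 1 -> Rabs (h (r * t) - k (s * t)) <= delta) ->
  Rabs (average n h r - average n k s) <= delta.
Proof.
  intros Hh Hk H. unfold average.
  rewrite <- (RInt_minus (V := R_CompleteNormedModule))
    by now apply average_integrable.
  replace delta with ((1 - 0) * delta) by ring.
  apply (abs_RInt_le_const
    (fun t => t ^ n * h (r * t) - t ^ n * k (s * t))).
  - lra.
  - apply (@ex_RInt_minus R_NormedModule); now apply average_integrable.
  - intros t Ht. rewrite <- Rmult_minus_distr_l, Rabs_mult.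
    assert (0 <= t ^ n <= 1).
    { split; [apply pow_le; lra|]. rewrite <- (pow1 n). apply pow_incr. lra. }
    rewrite (Rabs_pos_eq (t ^ n)) by lra.
    specialize (H t Ht). pose proof (Rabs_pos (h (r * t) - k (s * t))). nra.
Qed.

Lemma average_bound (n : nat) (h : R -> R) (r M : R) :
  (forall x, continuous h x) -> (forall t, Rabs (h t) <= M) ->
  Rabs (average n h r) <= M.
Proof.
  intros Hh HM.
  replace (average n h r) with (average n h r - average n (fun _ => 0) r).
  - apply average_dist; auto.
    + intros x. apply continuous_const.
    + intros t _. rewrite Rminus_0_r. apply HM.
  - unfold average. rewrite (RInt_ext (fun t => t ^ n * 0) (fun _ => 0)) by (intros; apply Rmult_0_r).
    rewrite RInt_const. unfold scal; simpl; unfold mult; simpl. ring.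
Qed.

Lemma average_lipschitz (n : nat) (h : R -> R) (K : R) :
  0 <= K -> lipschitz K h -> lipschitz K (average n h).
Proof.
  intros HK Hh r s.
  apply average_dist; try (intros x; now apply lipschitz_continuous with K).
  intros t Ht. eapply Rle_trans; [apply Hh|].
  apply Rmult_le_compat_l; [exact HK|].
  rewrite <- Rmult_minus_distr_r, Rabs_mult, (Rabs_pos_eq t) by lra.
  pose proof (Rabs_pos (r - s)). nra.
Qed.

Lemma average_scaled (n : nat) (h : R -> R) (r : R) :
  (forall x, continuous h x) -> r <> 0 ->
  average n h r = RInt (fun t => t ^ n * h t) 0 r / r ^ S n.
Proof.
  intros Hh Hr.
  assert (Hc : forall a b, ex_RInt (fun t => t ^ n * h t) a b).
  { intros a b. apply ex_RInt_ext with (fun t => t ^ n * h (1 * t)).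
    - intros t _. now rewrite Rmult_1_l.
    - now apply average_integrable. }
  (* Substitution of [r * t], in the affine form with shift [0]: one factor [r] comes from the
     differential and [r ^ n] from the weight. *)
  assert (H : is_RInt (fun t => scal r ((r * t + 0) ^ n * h (r * t + 0))) 0 1
                      (r ^ S n * average n h r)).
  { apply is_RInt_ext with (fun t => scal (r ^ S n) (t ^ n * h (r * t))).
    - intros t _. unfold scal; simpl; unfold mult; simpl.
      rewrite Rplus_0_r, Rpow_mult_distr. ring.
    - apply (is_RInt_scal (V := R_NormedModule)).
      apply (RInt_correct (V := R_CompleteNormedModule)).
      now apply average_integrable. }
  apply (is_RInt_unique (V := R_CompleteNormedModule)) in H.
  pose proof (eq_trans (eq_sym
    (RInt_comp_lin (fun t => t ^ n * h t) r 0 0 1 (Hc _ _))) H) as Hp.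
  replace (r * 0 + 0) with 0 in Hp by ring.
  replace (r * 1 + 0) with r in Hp by ring.
  rewrite Hp. field. now apply pow_nonzero.
Qed.

(* [s * average n h s] is [s^(-n)] times the integral of [t^n h t] over [0, s]. *)
Lemma is_derive_radial_flux (n : nat) (h : R -> R) (r : R) :
  (forall x, continuous h x) -> 0 < r ->
  is_derive (fun s => s * average n h s) r (h r - INR n * average n h r).
Proof.
  intros Hh Hr.
  (* The ball of radius [r] around [r] contains only positive points, where the scaled formula
     holds; the quotient rule then applies. *)
  apply is_derive_ext_loc with (fun s => RInt (fun t => t ^ n * h t) 0 s / s ^ n).
  - exists (mkposreal r Hr). intros s Hs.
    unfold ball in Hs; simpl in Hs; unfold AbsRing_ball, abs, minus, plus, opp in Hs;
    simpl in Hs. apply Rabs_def2 in Hs.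
    rewrite average_scaled; [|exact Hh|lra]. simpl. field.
    split; [apply pow_nonzero|]; lra.
  - assert (Hp : is_derive (fun s => RInt (fun t => t ^ n * h t) 0 s) r (r ^ n * h r)).
    { apply (is_derive_RInt (V := R_NormedModule) (fun t => t ^ n * h t) _ 0).
      - exists (mkposreal 1 Rlt_0_1). intros s _.
        apply (RInt_correct (V := R_CompleteNormedModule)).
        apply ex_RInt_ext with (fun t => t ^ n * h (1 * t)).
        + intros t _. now rewrite Rmult_1_l.
        + now apply average_integrable.
      - apply (continuous_mult (fun t => t ^ n) h); [|apply Hh].
        apply (@ex_derive_continuous _ R_NormedModule). auto_derive. exact I. }
    assert (Hrn : r ^ n <> 0) by (apply pow_nonzero; lra).
    pose proof (is_derive_div _ (fun s => s ^ n) r _ (INR n * 1 * r ^ pred n) Hp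
      (is_derive_pow (fun s => s) n r 1 (is_derive_id r)) Hrn) as Hd.
    rewrite average_scaled by (auto; lra).
    replace (h r - INR n * (RInt (fun t => t ^ n * h t) 0 r / r ^ S n)) with
     ((r ^ n * h r * r ^ n -
        RInt (fun t => t ^ n * h t) 0 r * (INR n * 1 * r ^ pred n)) / (r ^ n) ^ 2);
      [exact Hd|].
    (* [pred n] is [n - 1] only for positive [n]; at [n = 0] the factor [INR 0] removes that
       term. *)
    destruct n as [|n].
    + simpl; field. lra.
    + simpl. field.
      split; [apply pow_nonzero|]; lra.
Qed.

(** * The radial initial value problem *)

Lemma exp_nondecreasing (x y : R) : x <= y -> exp x <= exp y.
Proof.
  intros [H| ->]; [left; now apply exp_increasing|apply Rle_refl].
Qed.

(** Picard iteration on the integral form. Returning [A] with [W] writes the equation as a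
    first-order system whose data are continuous at the centre. The weight [exp (mu * r)] makes the
    map contracting for every [T]. *)
Lemma radial_ivp (n : nat) (g : R -> R) (L M T w0 : R) :
  0 <= L -> lipschitz L g -> (forall w, Rabs (g w) <= M) -> 0 < T ->
  exists W A : R -> R,
    (forall r, is_derive W r (- (r * A r))) /\
    (forall r, continuous A r) /\
    (forall r, 0 < r < T ->
       is_derive (fun s => s * A s) r (g (W r) - INR n * A r)) /\
    W 0 = w0.
Proof.
  intros HL Hg HM HT.
  assert (HM0 : 0 <= M) by (eapply Rle_trans; [apply Rabs_pos|apply (HM 0)]).
  assert (HTM : 0 <= T * M) by nra.
  pose (P := clamp 0 T).
  assert (HP : forall r, 0 <= P r <= T) by (intros r; apply clamp_range; lra).
  (* On [[0, T]] the integrand [F u] is at most [T * M], so every image under [Phi] has this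
     Lipschitz constant; the class is also stable under pointwise limits. *)
  pose (X := lipschitz (T * M)).
  assert (Hh : forall u, X u -> lipschitz (L * (T * M)) (fun t => g (u t))).
  { intros u Hu x y. eapply Rle_trans; [apply Hg|].
    rewrite Rmult_assoc. apply Rmult_le_compat_l; [exact HL|apply Hu]. }
  assert (Hhc : forall u, X u -> forall x, continuous (fun t => g (u t)) x).
  { intros u Hu x. apply lipschitz_continuous with (1 := Hh u Hu). }
  pose (F := fun u s => s * average n (fun t => g (u t)) s).
  assert (HAc : forall u, X u -> forall x, continuous (average n (fun t => g (u t))) x).
  { intros u Hu x. apply lipschitz_continuous with (L * (T * M)).
    apply average_lipschitz; [nra|now apply Hh]. }
  assert (HFc : forall u, X u -> forall x, continuous (F u) x).
  { intros u Hu x. apply (continuous_mult (fun s : R => s) (average n (fun t => g (u t)))).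
    - apply continuous_id.
    - now apply HAc. }
  assert (HFi : forall u, X u -> forall a b, is_RInt (F u) a b (RInt (F u) a b)).
  { intros u Hu a b. apply (RInt_correct (V := R_CompleteNormedModule)).
    apply (@ex_RInt_continuous R_CompleteNormedModule). intros x _. now apply HFc. }
  assert (HFb : forall u, X u -> forall s, 0 <= s <= T -> Rabs (F u s) <= T * M).
  { intros u Hu s Hs. unfold F. rewrite Rabs_mult, (Rabs_pos_eq s) by lra.
    apply Rmult_le_compat; try lra; [apply Rabs_pos|].
    apply average_bound; [now apply Hhc|intros; apply HM]. }
  assert (HRb : forall u, X u -> forall a b, 0 <= a <= T -> 0 <= b <= T ->
    Rabs (RInt (F u) a b) <= Rabs (b - a) * (T * M)).
  { intros u Hu a b Ha Hb.
    apply (norm_RInt_le_const_abs (V := R_NormedModule) (F u) a b); [|now apply HFi].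
    intros x Hx. apply HFb; [exact Hu|].
    unfold Rmin, Rmax in Hx. destruct (Rle_dec a b); lra. }
  pose (Phi := fun u r => w0 - RInt (F u) 0 (P r)).
  (* Chosen so that [T * L / mu <= 1 / 2]; the added [1] keeps [mu] positive when [L = 0]. *)
  pose (mu := 2 * L * T + 1).
  assert (Hmu : 0 < mu) by (unfold mu; nra).
  pose (wt := fun t => exp (mu * P t)).
  assert (Hwt : forall t, 1 <= wt t).
  { intros t. unfold wt. rewrite <- exp_0. specialize (HP t).
    apply exp_nondecreasing. nra. }
  destruct (weighted_fixed_point X Phi wt (fun _ => w0) (T * M * T))
    as [u [Hu Hfix]].
  - intros t. specialize (Hwt t). lra.
  - intros u Hu x y. unfold Phi.
    assert (HC : RInt (F u) 0 (P x) + RInt (F u) (P x) (P y) = RInt (F u) 0 (P y)).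
    { apply (RInt_Chasles (V := R_CompleteNormedModule));
        eexists; now apply HFi. }
    assert (HE : w0 - RInt (F u) 0 (P x) - (w0 - RInt (F u) 0 (P y)) =
                 RInt (F u) (P x) (P y)) by (rewrite <- HC; ring).
    rewrite HE. eapply Rle_trans; [apply HRb; auto|].
    pose proof (clamp_lipschitz 0 T y x) as H. fold P in H.
    rewrite (Rabs_minus_sym x y). nra.
  - intros u v delta Hu Hv Huv t. unfold Phi.
    assert (Hdelta : 0 <= delta).
    { specialize (Huv 0). specialize (Hwt 0). pose proof (Rabs_pos (u 0 - v 0)). nra. }
    replace (w0 - RInt (F u) 0 (P t) - (w0 - RInt (F v) 0 (P t)))
      with (- (RInt (F u) 0 (P t) - RInt (F v) 0 (P t))) by ring.
    rewrite Rabs_Ropp.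
    pose proof (HP t) as HPt.
    (* The points averaged at radius [s] lie in [[0, s]], where the weight is at most
       [exp (mu * s)]. Integrating this exponential gains the factor [1 / mu]. *)
    apply Rle_trans with
      (T * (L * delta) / mu * exp (mu * P t) - T * (L * delta) / mu * exp (mu * 0)).
    + apply (norm_RInt_le (V := R_NormedModule) (fun s => minus (F u s) (F v s))
        (fun s => T * (L * delta) * exp (mu * s)) 0 (P t)).
      * lra.
      * intros s Hs. change (Rabs (F u s - F v s) <= T * (L * delta) * exp (mu * s)).
        unfold F. rewrite <- Rmult_minus_distr_l, Rabs_mult, (Rabs_pos_eq s) by lra.
        rewrite (Rmult_assoc T).
        apply Rmult_le_compat; try lra; [apply Rabs_pos|].
        apply average_dist; try (now apply Hhc).
        intros r Hr. eapply Rle_trans; [apply Hg|].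
        rewrite Rmult_assoc. apply Rmult_le_compat_l; [exact HL|].
        eapply Rle_trans; [apply Huv|].
        apply Rmult_le_compat_l; [exact Hdelta|].
        unfold wt, P. rewrite clamp_id by nra.
        apply exp_nondecreasing. apply Rmult_le_compat_l; [lra|]. nra.
      * apply (is_RInt_minus (V := R_NormedModule)); now apply HFi.
      * apply (is_RInt_derive (V := R_CompleteNormedModule)
          (fun s => T * (L * delta) / mu * exp (mu * s))).
        -- intros x _. auto_derive; [exact I|field; lra].
        -- intros x _. apply (@ex_derive_continuous _ R_NormedModule).
           auto_derive. exact I.
    + rewrite Rmult_0_r, exp_0. fold (wt t).
      assert (Hq : T * (L * delta) / mu <= delta / 2).
      { apply Rmult_le_reg_r with mu; [exact Hmu|].
        replace (T * (L * delta) / mu * mu) with (T * (L * delta)) by (field; lra).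
        unfold mu. nra. }
      assert (Hq0 : 0 <= T * (L * delta) / mu).
      { apply Rdiv_le_0_compat; [|exact Hmu]. apply Rmult_le_pos; nra. }
      specialize (Hwt t). nra.
  - intros s u Hs Hlim x y.
    apply (is_lim_seq_le (fun k => Rabs (s k x - s k y)) (fun _ => T * M * Rabs (x - y))
       (Finite (Rabs (u x - u y))) (Finite (T * M * Rabs (x - y)))).
    + intros k. apply Hs.
    + apply (is_lim_seq_abs _ (Finite (u x - u y))). now apply is_lim_seq_minus'.
    + apply is_lim_seq_const.
  - intros x y. rewrite Rminus_diag, Rabs_R0. pose proof (Rabs_pos (x - y)). nra.
  - intros t. unfold Phi.
    replace (w0 - RInt (F (fun _ => w0)) 0 (P t) - w0)
      with (- RInt (F (fun _ => w0)) 0 (P t)) by ring.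
    rewrite Rabs_Ropp.
    assert (HXc : X (fun _ => w0)).
    { intros x y. rewrite Rminus_diag, Rabs_R0. pose proof (Rabs_pos (x - y)). nra. }
    specialize (HP t). specialize (Hwt t).
    eapply Rle_trans; [apply HRb; [exact HXc|lra|lra]|].
    rewrite Rminus_0_r, Rabs_pos_eq by lra.
    assert (P t * (T * M) <= T * (T * M)) by (apply Rmult_le_compat_r; lra).
    assert (0 <= T * (T * M)) by nra. nra.
  (* Dropping the clamp makes [W] differentiable everywhere; it agrees with the fixed point [u] on
     [[0, T]], where the second equation is claimed. *)
  - exists (fun r => w0 - RInt (F u) 0 r), (average n (fun t => g (u t))).
    split; [|split; [now apply HAc|split]].
    + intros r.
      replace (- (r * average n (fun t => g (u t)) r)) with (minus 0 (F u r))
        by (unfold F, minus, plus, opp; simpl; ring).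
      apply (is_derive_minus (V := R_NormedModule) (fun _ => w0) (RInt (F u) 0)).
      * apply (is_derive_const (V := R_NormedModule)).
      * apply (is_derive_RInt (V := R_NormedModule) (F u) _ 0); [|now apply HFc].
        exists (mkposreal 1 Rlt_0_1). intros s _. now apply HFi.
    + intros r Hr.
      replace (w0 - RInt (F u) 0 r) with (u r).
      * apply (is_derive_radial_flux n (fun t => g (u t))); [now apply Hhc|lra].
      * rewrite Hfix. unfold Phi, P. now rewrite clamp_id by lra.
    + rewrite (RInt_point (V := R_CompleteNormedModule)). unfold zero; simpl. ring.
Qed.

(** * Energy decay and the potential barrier *)

(** Since [W' = - s A], the derivative of [E] is the friction term [- n s A^2]. At the centre the
    kinetic part vanishes, and at [r] it is nonnegative. *)
Lemma energy_nonincreasing (n : nat) (g G W A : R -> R) (T r : R) :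
  (forall w, is_derive G w (g w)) ->
  (forall s, is_derive W s (- (s * A s))) ->
  (forall s, continuous A s) ->
  (forall s, 0 < s < T ->
     is_derive (fun s => s * A s) s (g (W s) - INR n * A s)) ->
  0 <= r < T -> G (W r) <= G (W 0).
Proof.
  intros HG HW HA HF [[Hr|<-] HrT]; [|apply Rle_refl].
  pose (E := fun s => (s * A s) * (s * A s) / 2 + G (W s)).
  assert (HFc : forall s, continuous (fun s => s * A s) s).
  { intros s. apply (continuous_mult (fun s : R => s) A);
      [apply continuous_id|apply HA]. }
  assert (HGW : forall s, is_derive (fun s => G (W s)) s (- (s * A s) * g (W s))).
  { intros s. apply (is_derive_comp G W); [apply HG|apply HW]. }
  (* The equation is available only for [s > 0], so at the centre the mean value theorem relies on
     continuity of [E]. *)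
  destruct (MVT_gen E 0 r (fun s => - (INR n * s * (A s * A s)))) as [c [Hc HE]].
  - rewrite Rmin_left, Rmax_right by lra. intros s Hs.
    specialize (HF s ltac:(lra)).
    pose proof (is_derive_mult _ _ s _ _ HF HF Rmult_comm) as H2.
    pose proof (is_derive_scal _ s (/ 2) _ H2) as H3.
    pose proof (is_derive_plus _ _ s _ _ H3 (HGW s)) as H4.
    replace (- (INR n * s * (A s * A s))) with
      (/ 2 * ((g (W s) - INR n * A s) * (s * A s) +
              (s * A s) * (g (W s) - INR n * A s)) + - (s * A s) * g (W s))
      by field.
    eapply is_derive_ext; [|exact H4].
    intros t. change (/ 2 * (t * A t * (t * A t)) + G (W t) = E t).
    unfold E. field.
  - intros s _. apply continuity_pt_filterlim.
    apply (continuous_plus (fun s => s * A s * (s * A s) / 2) (fun s => G (W s))).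
    + apply (continuous_mult (fun s => s * A s * (s * A s)) (fun _ => / 2)).
      * apply (continuous_mult (fun s => s * A s) (fun s => s * A s)); apply HFc.
      * apply continuous_const.
    + apply (@ex_derive_continuous _ R_NormedModule). eexists. apply HGW.
  - rewrite Rmin_left, Rmax_right in Hc by lra.
    unfold E in HE. rewrite !Rmult_0_l in HE.
    assert (0 <= INR n * c * (A c * A c) * r).
    { apply Rmult_le_pos; [|lra]. apply Rmult_le_pos; [|apply Rle_0_sqr].
      apply Rmult_le_pos; [apply pos_INR|lra]. }
    pose proof (Rle_0_sqr (r * A r)) as Hs. unfold Rsqr in Hs. lra.
Qed.

(** [G] does not decrease on [[0, 1/2]] and [[1, w]], and has slope at least [c / 2] on [[1/2, 1]],
    which gives [c / 4]. *)
Lemma potential_coercive_right (g G : R -> R) (c w : R) :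
  (forall w, is_derive G w (g w)) ->
  (forall w, 0 <= w -> 0 <= g w) ->
  (forall w, 0 <= w <= 1 -> c * w <= g w) ->
  1 <= w -> c / 4 <= G w - G 0.
Proof.
  intros HG Hpos Hc Hw.
  assert (Hmvt : forall a b m, a <= b -> (forall x, a <= x <= b -> m <= g x) ->
    m * (b - a) <= G b - G a).
  { intros a b m Hab Hm.
    destruct (MVT_gen G a b g) as [x [Hx HE]].
    - intros x _. apply HG.
    - intros x _. apply continuity_pt_filterlim.
      apply (@ex_derive_continuous _ R_NormedModule). eexists. apply HG.
    - rewrite Rmin_left, Rmax_right in Hx by lra. rewrite HE.
      apply Rmult_le_compat_r; [lra|]. now apply Hm. }
  pose proof (Hmvt 0 (1 / 2) 0 ltac:(lra) ltac:(intros; apply Hpos; lra)).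
  pose proof (Hmvt 1 w 0 ltac:(lra) ltac:(intros; apply Hpos; lra)).
  assert (Hc2 : c / 2 * (1 - 1 / 2) <= G 1 - G (1 / 2)).
  { apply Hmvt; [lra|]. intros x Hx.
    destruct (Rle_dec 0 c); [|pose proof (Hpos x); lra].
    pose proof (Hc x). nra. }
  lra.
Qed.

(** A barrier: reaching [Rabs w = 1] costs potential energy at least [c / 4]. Negative [w] reduces
    to the positive case by the reflection [x -> - g (- x)]. *)
Lemma potential_coercive (g G : R -> R) (c w : R) :
  (forall w, is_derive G w (g w)) ->
  (forall w, 0 <= w * g w) ->
  (forall w, Rabs w <= 1 -> c * (w * w) <= w * g w) ->
  g 0 = 0 -> 1 <= Rabs w -> c / 4 <= G w - G 0.
Proof.
  intros HG Hpos Hc H0 Hw.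
  assert (Hp1 : forall x, 0 <= x -> 0 <= g x).
  { intros x [Hx|<-]; [|lra]. pose proof (Hpos x). nra. }
  assert (Hp2 : forall x, 0 <= x -> 0 <= - g (- x)).
  { intros x [Hx|<-]; [|rewrite Ropp_0; lra]. pose proof (Hpos (- x)). nra. }
  assert (Hc1 : forall x, 0 <= x <= 1 -> c * x <= g x).
  { intros x [[Hx|<-] Hx1]; [|lra].
    specialize (Hc x ltac:(rewrite Rabs_pos_eq; lra)). nra. }
  assert (Hc2 : forall x, 0 <= x <= 1 -> c * x <= - g (- x)).
  { intros x [[Hx|<-] Hx1]; [|rewrite Ropp_0; lra].
    specialize (Hc (- x) ltac:(rewrite Rabs_Ropp, Rabs_pos_eq; lra)). nra. }
  unfold Rabs in Hw. destruct (Rcase_abs w).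
  - rewrite <- (Ropp_involutive w), <- (Ropp_0).
    apply (potential_coercive_right (fun x => - g (- x)) (fun x => G (- x))); auto.
    intros x. replace (- g (- x)) with (-1 * g (- x)) by ring.
    apply (is_derive_comp G Ropp); [apply HG|].
    auto_derive; [exact I|ring].
  - now apply (potential_coercive_right g G); auto; lra.
Qed.

(** * Oscillation *)

(* Riccati substitution: [z = - W' / W] satisfies [z' >= (k^2 + z^2) / 2], so
   [atan (z / k)] grows at rate at least [k / 2] as long as [W] does not vanish. *)
Lemma oscillation (n : nat) (k r0 : R) (W A gam : R -> R) :
  0 < k -> 0 < r0 -> INR n <= k * r0 ->
  (forall s, r0 <= s <= r0 + 2 * PI / k -> is_derive W s (- (s * A s))) ->
  (forall s, r0 <= s <= r0 + 2 * PI / k ->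
     is_derive (fun s => s * A s) s (gam s - INR n * A s)) ->
  (forall s, r0 <= s <= r0 + 2 * PI / k -> k ^ 2 * (W s * W s) <= gam s * W s) ->
  exists r, r0 <= r <= r0 + 2 * PI / k /\ W r = 0.
Proof.
  intros Hk Hr0 Hn HW HF Hgam. apply NNPP. intros Hno.
  assert (Hnz : forall s, r0 <= s <= r0 + 2 * PI / k -> W s <> 0).
  { intros s Hs HWs. apply Hno. now exists s. }
  assert (HPI : 0 < 2 * PI / k).
  { apply Rdiv_lt_0_compat; [|exact Hk]. pose proof PI_RGT_0. lra. }
  pose (Z := fun s => s * A s / (k * W s)).
  pose (dZ := fun s => ((gam s - INR n * A s) * (k * W s) -
                        s * A s * (k * - (s * A s))) / (k * W s) ^ 2).
  assert (HkW : forall s, r0 <= s <= r0 + 2 * PI / k -> k * W s <> 0).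
  { intros s Hs. apply Rmult_integral_contrapositive. split; [lra|auto]. }
  assert (HZ : forall s, r0 <= s <= r0 + 2 * PI / k -> is_derive Z s (dZ s)).
  { intros s Hs. apply (is_derive_div (fun s => s * A s) (fun s => k * W s)); auto.
    apply (is_derive_scal W). auto. }
  assert (Hth : forall s, r0 <= s <= r0 + 2 * PI / k ->
    is_derive (fun s => atan (Z s)) s (dZ s * / (1 + Z s ^ 2))).
  { intros s Hs. apply (is_derive_comp atan Z); [|auto].
    pose proof (is_derive_atan (Z s)) as Ha. unfold Rsqr in Ha.
    replace (Z s ^ 2) with (Z s * Z s) by ring. exact Ha. }
  destruct (MVT_gen (fun s => atan (Z s)) r0 (r0 + 2 * PI / k)
              (fun s => dZ s * / (1 + Z s ^ 2))) as [c [Hc HE]].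
  - rewrite Rmin_left, Rmax_right by lra. intros s Hs. apply Hth. lra.
  - rewrite Rmin_left, Rmax_right by lra. intros s Hs.
    apply continuity_pt_filterlim.
    apply (ex_derive_continuous (V := R_NormedModule) (fun s => atan (Z s))).
    exact (ex_intro _ _ (Hth s Hs)).
  - rewrite Rmin_left, Rmax_right in Hc by lra.
    specialize (Hgam c Hc). specialize (HkW c Hc).
    (* Because [n <= k * r0 <= k * c], the inequality between arithmetic and geometric means lets
       friction absorb at most half of [k^2 W^2 + (c A)^2]. *)
    assert (Hcross : INR n * A c * W c <= k ^ 2 * (W c * W c) / 2 + (c * A c) * (c * A c) / 2).
    { apply Rle_trans with (INR n * (Rabs (A c) * Rabs (W c))).
      - rewrite Rmult_assoc, <- Rabs_mult.
        apply Rmult_le_compat_l; [apply pos_INR|apply Rle_abs].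
      - apply Rle_trans with (k * c * (Rabs (A c) * Rabs (W c))).
        + apply Rmult_le_compat_r.
          * apply Rmult_le_pos; apply Rabs_pos.
          * nra.
        + pose proof (Rsqr_abs (A c)) as Ha. pose proof (Rsqr_abs (W c)) as Hw.
          unfold Rsqr in Ha, Hw.
          replace (c * A c * (c * A c)) with (c * c * (A c * A c)) by ring.
          rewrite Ha, Hw.
          pose proof (Rle_0_sqr (k * Rabs (W c) - c * Rabs (A c))) as Hs.
          unfold Rsqr in Hs. nra. }
    assert (Hrate : k / 2 <= dZ c * / (1 + Z c ^ 2)).
    { assert (HW2 : 0 < (k * W c) ^ 2) by (apply pow2_gt_0; exact HkW).
      assert (Hden : 0 < (k * W c) ^ 2 + (c * A c) ^ 2) by nra.
      replace (dZ c * / (1 + Z c ^ 2)) with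
        (k * (gam c * W c - INR n * A c * W c + (c * A c) * (c * A c)) /
          ((k * W c) ^ 2 + (c * A c) ^ 2)).
      - apply Rmult_le_reg_r with (1 := Hden).
        unfold Rdiv at 2. rewrite Rmult_assoc, Rinv_l by lra. rewrite Rmult_1_r.
        replace (k / 2 * ((k * W c) ^ 2 + (c * A c) ^ 2)) with
          (k * (k ^ 2 * (W c * W c) / 2 + (c * A c) * (c * A c) / 2)) by field.
        apply Rmult_le_compat_l; lra.
      - unfold dZ, Z. field. repeat split; try lra; try nra. }
    (* The growth over the whole interval is at least [PI], whereas two values of [atan] differ by
       strictly less. *)
    assert (Hgrow : k / 2 * (2 * PI / k) <= atan (Z (r0 + 2 * PI / k)) - atan (Z r0)).
    { rewrite HE. replace (r0 + 2 * PI / k - r0) with (2 * PI / k) by ring.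
      apply Rmult_le_compat_r; lra. }
    replace (k / 2 * (2 * PI / k)) with PI in Hgrow by (field; lra).
    pose proof (atan_bound (Z (r0 + 2 * PI / k))). pose proof (atan_bound (Z r0)). lra.
Qed.

(** * Estimates for the hyperbolic sine *)

Lemma cosh_ge_1 (x : R) : 1 <= cosh x.
Proof.
  unfold cosh. pose proof (exp_pos x). pose proof (exp_pos (- x)).
  assert (exp x * exp (- x) = 1) by (rewrite <- exp_plus, Rplus_opp_r; apply exp_0).
  pose proof (pow2_ge_0 (exp x - exp (- x))).
  assert (2 <= exp x + exp (- x)) by (apply Rnot_lt_le; intro; nra).
  lra.
Qed.

Lemma cosh_le_exp_Rabs (x : R) : cosh x <= exp (Rabs x).
Proof.
  unfold cosh.
  assert (exp x <= exp (Rabs x)) by apply exp_nondecreasing, Rle_abs.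
  assert (exp (- x) <= exp (Rabs x)).
  { apply exp_nondecreasing. rewrite <- Rabs_Ropp. apply Rle_abs. }
  lra.
Qed.

Lemma sinh_increment (x y : R) :
  exists c, Rmin y x <= c <= Rmax y x /\ sinh x - sinh y = cosh c * (x - y).
Proof.
  apply (MVT_gen sinh y x cosh).
  - intros c _. apply is_derive_Reals, derivable_pt_lim_sinh.
  - intros c _. apply derivable_continuous_pt. eexists. apply derivable_pt_lim_sinh.
Qed.

(** The mean value point lies within [1] of [a], where [cosh] is at most [exp (Rabs a + 1)]. *)
Lemma sinh_lipschitz (a x y : R) : Rabs x <= 1 -> Rabs y <= 1 ->
  Rabs (sinh (a + x) - sinh (a + y)) <= exp (Rabs a + 1) * Rabs (x - y).
Proof.
  intros Hx Hy.
  destruct (sinh_increment (a + x) (a + y)) as [c [Hc ->]].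
  replace (a + x - (a + y)) with (x - y) by ring.
  rewrite Rabs_mult. apply Rmult_le_compat_r; [apply Rabs_pos|].
  pose proof (cosh_ge_1 c). rewrite Rabs_pos_eq by lra.
  eapply Rle_trans; [apply cosh_le_exp_Rabs|]. apply exp_nondecreasing.
  apply Rabs_le_between in Hx, Hy.
  assert (Hc' : a - 1 <= c <= a + 1).
  { unfold Rmin, Rmax in Hc. destruct (Rle_dec _ _); lra. }
  unfold Rabs. destruct (Rcase_abs c); destruct (Rcase_abs a); lra.
Qed.

(** Follows from [cosh >= 1]. It supplies both the sign of the restoring force and the lower bound
    used in the Riccati argument. *)
Lemma sinh_increment_sign (a x : R) : x * x <= x * (sinh (a + x) - sinh a).
Proof.
  destruct (sinh_increment (a + x) a) as [c [_ ->]].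
  pose proof (cosh_ge_1 c). replace (a + x - a) with x by ring.
  pose proof (Rle_0_sqr x) as Hx. unfold Rsqr in Hx. nra.
Qed.

(** * Small oscillations about the trivial value *)

(* [g] is the restoring force, frozen outside [-1, 1] so as to be bounded and
   Lipschitz; the energy bound keeps the solution in the unmodified range. *)
Lemma small_oscillation (n : nat) (k a T : R) : 0 < k -> 0 < T ->
  exists (W A : R -> R),
    (forall r, is_derive W r (- (r * A r))) /\
    (forall r, continuous A r) /\
    (forall r, 0 < r < T ->
       is_derive (fun s => s * A s) r
         (k ^ 2 * (sinh (a + W r) - sinh a) - INR n * A r)) /\
    W 0 <> 0.
Proof.
  intros Hk HT.
  pose (g := fun w => k ^ 2 * (sinh (a + clamp (-1) 1 w) - sinh a)).
  (* Serves both as Lipschitz constant of [g] and, since [g 0 = 0] and the clamp lies in [[-1, 1]],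
     as its sup bound. *)
  pose (L := k ^ 2 * exp (Rabs a + 1)).
  assert (Hk2 : 0 < k ^ 2) by (apply pow_lt; exact Hk).
  assert (HL : 0 < L) by (apply Rmult_lt_0_compat; [exact Hk2|apply exp_pos]).
  assert (Hcl : forall w, Rabs (clamp (-1) 1 w) <= 1).
  { intros w. apply Rabs_le_between, clamp_range. lra. }
  assert (Hgdiff : forall x y, Rabs (g x - g y) <=
    L * Rabs (clamp (-1) 1 x - clamp (-1) 1 y)).
  { intros x y. unfold g, L.
    rewrite <- Rmult_minus_distr_l, Rabs_mult, Rabs_pos_eq, Rmult_assoc by lra.
    apply Rmult_le_compat_l; [lra|].
    replace (sinh (a + clamp (-1) 1 x) - sinh a - (sinh (a + clamp (-1) 1 y) - sinh a))
      with (sinh (a + clamp (-1) 1 x) - sinh (a + clamp (-1) 1 y)) by ring.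
    now apply sinh_lipschitz. }
  assert (Hg : lipschitz L g).
  { intros x y. eapply Rle_trans; [apply Hgdiff|].
    apply Rmult_le_compat_l; [lra|].
    rewrite <- (Rmult_1_l (Rabs (x - y))). apply clamp_lipschitz. }
  assert (Hg0 : g 0 = 0).
  { unfold g. rewrite clamp_id, Rplus_0_r by lra. ring. }
  assert (HM : forall w, Rabs (g w) <= L).
  { intros w. rewrite <- (Rminus_0_r (g w)), <- Hg0.
    eapply Rle_trans; [apply Hgdiff|].
    rewrite (clamp_id _ _ 0), Rminus_0_r by lra.
    specialize (Hcl w). nra. }
  pose (G := RInt g 0).
  assert (HG : forall w, is_derive G w (g w)).
  { assert (Hgc : forall w, continuous g w)
      by (intros w; now apply lipschitz_continuous with L).
    intros w. apply (is_derive_RInt (V := R_NormedModule) g G 0); [|apply Hgc].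
    exists (mkposreal 1 Rlt_0_1). intros s _.
    apply (RInt_correct (V := R_CompleteNormedModule)).
    apply (@ex_RInt_continuous R_CompleteNormedModule). intros x _. apply Hgc. }
  assert (Hsign : forall x, Rabs x <= 1 -> k ^ 2 * (x * x) <= x * g x).
  { intros x Hx. unfold g. rewrite clamp_id by now apply Rabs_le_between.
    pose proof (sinh_increment_sign a x). nra. }
  (* [g] sees only the clamped argument, and clamping to [[-1, 1]] preserves the sign. *)
  assert (Hpos : forall x, 0 <= x * g x).
  { intros x. pose proof (Hsign (clamp (-1) 1 x) (Hcl x)) as Hx.
    assert (Hgx : g (clamp (-1) 1 x) = g x).
    { unfold g. rewrite (clamp_id _ _ (clamp (-1) 1 x)); [reflexivity|].
      apply clamp_range. lra. }
    rewrite Hgx in Hx.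
    pose proof (Rle_0_sqr (clamp (-1) 1 x)) as Hs. unfold Rsqr in Hs.
    assert (Hc : 0 <= clamp (-1) 1 x * g x) by nra.
    clear Hx Hgx Hs. unfold clamp, Rmin in Hc.
    destruct (Rle_dec x 1); unfold Rmax in Hc; destruct (Rle_dec _ _); nra. }
  (* Makes the initial energy at most [L * w0 = k ^ 2 / 8], below the barrier [k ^ 2 / 4]. *)
  pose (w0 := k ^ 2 / (8 * L)).
  assert (Hw0 : 0 < w0) by (apply Rdiv_lt_0_compat; lra).
  assert (HGw0 : G w0 - G 0 <= k ^ 2 / 8).
  { destruct (MVT_gen G 0 w0 g) as [c [_ HE]].
    - intros x _. apply HG.
    - intros x _. apply continuity_pt_filterlim.
      apply (@ex_derive_continuous _ R_NormedModule). exact (ex_intro _ _ (HG x)).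
    - rewrite HE.
      replace (k ^ 2 / 8) with (L * (w0 - 0)) by (unfold w0; field; lra).
      apply Rmult_le_compat_r; [lra|].
      eapply Rle_trans; [apply Rle_abs|apply HM]. }
  destruct (radial_ivp n g L L T w0) as (W & A & HW & HA & HF & HW0); try lra; auto.
  exists W, A. split; [exact HW|split; [exact HA|split]].
  - intros r Hr.
    replace (k ^ 2 * (sinh (a + W r) - sinh a)) with (g (W r)); [now apply HF|].
    unfold g. rewrite clamp_id; [reflexivity|].
    apply Rabs_le_between. destruct (Rle_dec (Rabs (W r)) 1) as [H1|H1]; [exact H1|].
    pose proof (potential_coercive g G (k ^ 2) (W r) HG Hpos Hsign Hg0 ltac:(lra)).
    pose proof (energy_nonincreasing n g G W A T r HG HW HA HF ltac:(lra)) as HE.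
    rewrite HW0 in HE. lra.
  - rewrite HW0. lra.
Qed.

(** * Construction of the non-trivial solution *)

Theorem propositionB1 (d : nat) (kappa lambda C_B : R)
  (hd : (1 <= d)%nat) (hkappa : 0 < kappa) (hlambda : 0 <= lambda)
  (hC_B : is_ball_constant d C_B) :
  exists (rho : R) (y : R -> R),
    rho > C_B / kappa /\
    radial_solution d kappa lambda rho y /\
    (exists r : R, 0 <= r <= rho /\ y r <> trivial_value kappa lambda).
Proof.
  destruct d as [|n]; [lia|].
  pose (a := trivial_value kappa lambda).
  assert (Ha : kappa ^ 2 * sinh a = lambda).
  { unfold a, trivial_value. rewrite sinh_arcsinh. field. lra. }
  (* Beyond [r0] the friction is weak enough for oscillation and the radius exceeds [C_B / kappa],
     so any zero found there is admissible. *)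
  pose (r0 := INR n / kappa + Rabs (C_B / kappa) + 1).
  assert (Hnk : 0 <= INR n / kappa)
    by (apply Rdiv_le_0_compat; [apply pos_INR|exact hkappa]).
  pose proof (Rabs_pos (C_B / kappa)) as HCpos.
  pose proof (Rle_abs (C_B / kappa)) as HCle.
  assert (HPI : 0 < 2 * PI / kappa).
  { apply Rdiv_lt_0_compat; [|exact hkappa]. pose proof PI_RGT_0. lra. }
  (* The added [1] keeps the zero strictly inside the interval where the equation holds. *)
  pose (T := r0 + 2 * PI / kappa + 1).
  destruct (small_oscillation n kappa a T) as (W & A & HW & HA & HF & HW0).
  { exact hkappa. }
  { unfold T, r0. lra. }
  destruct (oscillation n kappa r0 W A
    (fun r => kappa ^ 2 * (sinh (a + W r) - sinh a))) as (rho & Hrho & Hzero).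
  { exact hkappa. }
  { unfold r0. lra. }
  { replace (INR n) with (kappa * (INR n / kappa)) by (field; lra).
    apply Rmult_le_compat_l; unfold r0; lra. }
  { intros s _. apply HW. }
  { intros s Hs. apply HF. unfold T, r0 in *. lra. }
  { intros s _. pose proof (sinh_increment_sign a (W s)).
    pose proof (pow2_ge_0 kappa). cbv beta. nra. }
  assert (Hrho0 : C_B / kappa < rho /\ 0 < rho < T) by (unfold T, r0 in *; lra).
  pose (y := fun r => a + W r).
  assert (Hy : forall r, is_derive y r (- (r * A r))).
  { intros r. rewrite <- (Rplus_0_l (- (r * A r))).
    apply (is_derive_plus (fun _ => a) W); [|apply HW].
    apply (is_derive_const (V := R_NormedModule)). }
  assert (Hy1 : forall r, Derive y r = - (r * A r))
    by (intros r; apply is_derive_unique, Hy).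
  assert (Hyc : forall r, continuous y r).
  { intros r. apply (@ex_derive_continuous _ R_NormedModule).
    exact (ex_intro _ _ (Hy r)). }
  (* A formula for [y''] that is continuous on the whole line: it gives continuity of [y''] inside,
     and its value at [0] is the limit required at the centre. *)
  pose (f := fun r => - (kappa ^ 2 * (sinh (y r) - sinh a) - INR n * A r)).
  assert (Hy2 : forall r, 0 < r < T -> is_derive (Derive y) r (f r)).
  { intros r Hr.
    apply is_derive_ext with (fun s => - (s * A s)); [intros; now rewrite Hy1|].
    apply (is_derive_opp (fun s => s * A s)). now apply HF. }
  assert (Hy2' : forall r, 0 < r < T -> f r = Derive_n y 2 r).
  { intros r Hr. symmetry. apply is_derive_unique. now apply Hy2. }
  assert (Hfc : forall r, continuous f r).
  { intros r. apply (continuous_opp (V := R_NormedModule)).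
    apply (continuous_minus (V := R_NormedModule)
      (fun r => kappa ^ 2 * (sinh (y r) - sinh a)) (fun r => INR n * A r)).
    - apply (continuous_comp y (fun v => kappa ^ 2 * (sinh v - sinh a))); [apply Hyc|].
      apply (@ex_derive_continuous _ R_NormedModule).
      unfold sinh. auto_derive. exact I.
    - apply (continuous_mult (fun _ => INR n) A); [apply continuous_const|apply HA]. }
  (* Non-triviality is witnessed at the centre, where [W 0 <> 0]. *)
  exists rho, y. split; [lra|]. split; [|exists 0; split; [lra|unfold y; fold a; lra]].
  split; [|split; [|split; [|split]]].
  - intros r Hr. split; [exact (ex_intro _ _ (Hy r))|].
    split; [exact (ex_intro _ _ (Hy2 r ltac:(lra)))|].
    apply continuous_ext_loc with f; [|apply Hfc].
    apply (filter_imp (fun s => 0 < s /\ s < T)); [intros s Hs; apply Hy2'; lra|].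
    apply filter_and; [apply (open_gt 0)|apply (open_lt T)]; lra.
  - apply continuous_on_forall. intros r _. apply Hyc.
  - split.
    + apply filterlim_ext with (fun s => - (s * A s)); [intros; now rewrite Hy1|].
      replace 0 with (- (0 * A 0)) at 2 by ring.
      apply (filterlim_filter_le_1 _ (filter_le_within _)).
      apply (continuous_opp (V := R_NormedModule) (fun s => s * A s)).
      apply (continuous_mult (fun s : R => s) A); [apply continuous_id|apply HA].
    + exists (f 0). apply filterlim_ext_loc with f.
      * apply (filter_imp (fun s => 0 < s /\ s < T)); [intros s Hs; apply Hy2'; lra|].
        apply filter_and.
        -- exists (mkposreal 1 Rlt_0_1). now intros s _ Hs.
        -- apply filter_le_within. apply (open_lt T). lra.
      * apply (filterlim_filter_le_1 _ (filter_le_within _)). apply Hfc.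
  - intros r Hr. rewrite <- Hy2' by lra. rewrite Hy1, S_INR, <- Ha. unfold f. ring.
  - unfold y. rewrite Hzero. apply Rplus_0_r.
Qed.
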